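(* Let $\mathcal B$ be a separable complex Banach space, let $U\subset\mathbb C$ be open and connected, let $z_0\in U$, and let $A:U\to\mathcal L_{\mathcal B}$ be an analytic function such that $A(z)$ is Fredholm for every $z\in U$, invertible for every $z\in U\setminus\{z_0\}$, and not invertible at $z=z_0$. Let $P_k$, $Q_k$, $A^{[k]}$ and $d>0$ be as in the context, with $A^{[d]}(z_0)$ invertible, and suppose that $P_0=0$, $P_d\ne I$, and $P_{d+j}=I$ for $j>0$; thus $A(z)^{-1}$ has a pole of order $d$ at $z_0$. Let $H_{j,z_0}$ ($j\ge0$) be the Taylor coefficients at $z_0$ of $(A^{[d]}(z))^{-1}=\sum_{j=0}^\infty H_{j,z_0}(z-z_0)^j$. Then the inverse $A(z)^{-1}$ admits the Laurent series (around $z=z_0$) $$A(z)^{-1}=\sum_{j=-d}^\infty\Psi_j(z-z_0)^j,$$ where $$\Psi_j=\begin{cases}\sum_{\ell=0}^{j+d}H_{j+d-\ell,z_0}(P_{d+1-\ell}-P_{d-\ell})&\text{if }j<0,\\\sum_{\ell=0}^dH_{j+\ell,z_0}(P_{\ell+1}-P_\ell)&\text{if }j\ge0.\end{cases}$$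
   Context: $\mathcal L_{\mathcal B}$ is the space of bounded linear operators on $\mathcal B$ and $I$ is the identity. A projection is a bounded idempotent operator. An operator $T\in\mathcal L_{\mathcal B}$ is Fredholm if $\dim(\ker T)<\infty$ and $\dim(\operatorname{coker}T)<\infty$. Successive factorization: starting from $A^{[0]}=A$, for $k=1,2,\ldots$ let $P_k$ be a projection with $\operatorname{ran}P_k=\operatorname{ran}A^{[k-1]}(z_0)$ (no other requirement is imposed on $P_k$; in particular its kernel may be any convenient choice), let $Q_k=I-P_k$, and let $A^{[k]}$, called the Fredholm quotient of order $k$, be the analytic function on $U$, with values Fredholm operators of index zero, satisfying $A^{[k-1]}(z)=(P_k+(z-z_0)Q_k)A^{[k]}(z)$ for $z\in U$ (so $A^{[k]}(z)=(P_k+(z-z_0)^{-1}Q_k)A^{[k-1]}(z)$ for $z\ne z_0$, extended analytically to $z_0$). The integer $d>0$ is such that $A(z)=(P_1+(z-z_0)Q_1)\cdots(P_d+(z-z_0)Q_d)A^{[d]}(z)$ with $A^{[d]}$ analytic and $A^{[d]}(z_0)$ invertible; then $\operatorname{ran}P_1\subset\cdots\subset\operatorname{ran}P_d$.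
   Formalization: The nesting ran P_1 ⊂ … ⊂ ran P_d, stated in the context as a consequence, is assumed as a hypothesis; it does not follow from the rest, and the formula fails without it, e.g. for A(z)=[[1,0],[z,z²]] at z_0=0. *)

(* Defs.v *)
From HB Require Import structures.
From mathcomp Require Import all_boot all_order all_algebra.
From mathcomp Require Import complex.
From mathcomp Require Import all_classical all_reals all_analysis.

Set Implicit Arguments.
Unset Strict Implicit.
Unset Printing Implicit Defensive.

Import Order.TTheory GRing.Theory Num.Theory.
Import numFieldNormedType.Exports.

Local Open Scope classical_set_scope.
Local Open Scope ring_scope.

(* [R[i]] itself is canonically a module over [R]; a name typed as a
   [numClosedFieldType] selects instead the norm, topology and module structure
   of a field over itself. *)
Definition cplx (R : realType) : numClosedFieldType := R[i].

Lemma cplx_lecR (R : realType) (a b : R) :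
  (a%:C%C <= b%:C%C :> cplx R) = (a <= b).
Proof. exact: lecR. Qed.

Section BoundedOperators.
Context {R : realType} (V : normedModType (cplx R)).

Definition bounded_linear (f : V -> V) : Prop :=
  linear f /\ exists M : cplx R, forall x, `|f x| <= M * `|x|.

Definition bounded_linear_pred : {pred V -> V} :=
  fun f => `[< bounded_linear f >].

Record bop := Bop {
  bop_fun :> V -> V ;
  bop_subproof : bop_fun \in bounded_linear_pred }.

HB.instance Definition _ := [isSub for bop_fun].
HB.instance Definition _ := [Choice of bop by <:].

Lemma bounded_linearP (f : V -> V) :
  reflect (bounded_linear f) (f \in bounded_linear_pred).
Proof. exact: asboolP. Qed.

Lemma bop_ext (S T : bop) : (forall x, S x = T x) -> S = T.
Proof. by move=> ST; apply/val_inj/funext. Qed.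

Lemma bop_linear (T : bop) : linear T.
Proof. by case: T => f /= /bounded_linearP[]. Qed.

HB.instance Definition _ (T : bop) :=
  GRing.isLinear.Build (cplx R) V V _ T (bop_linear T).

Arguments bop_fun : simpl never.

Lemma bounded_linear_submod_closed : submod_closed bounded_linear_pred.
Proof.
split.
  apply/bounded_linearP; split; first by move=> a x y; rewrite scaler0 addr0.
  by exists 0 => x; rewrite normr0 mul0r.
move=> a f g /bounded_linearP[lf [M fM]] /bounded_linearP[lg [N gN]].
apply/bounded_linearP; split.
  move=> c x y; rewrite !fctE lf lg !scalerDr !scalerA (mulrC a c) addrACA.
  by [].
exists (`|a| * M + N) => x; rewrite (le_trans (ler_normD _ _))//.
by rewrite mulrDl lerD// normrZ -mulrA ler_wpM2l.
Qed.

HB.instance Definition _ :=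
  GRing.isSubmodClosed.Build _ _ bounded_linear_pred
    bounded_linear_submod_closed.
HB.instance Definition _ := [SubChoice_isSubLmodule of bop by <:].

Lemma bop_boundW (T : bop) :
  exists2 M : R, 0 <= M & forall x, `|T x| <= M%:C%C * `|x|.
Proof.
have /bounded_linearP[_ [M fM]] := bop_subproof T.
exists `|complex.Re M|; first exact: normr_ge0.
move=> x; have [->|x0] := eqVneq x 0.
  by have := fM 0; rewrite normr0 !mulr0.
have nx : 0 < `|x| by rewrite normr_gt0.
apply: (le_trans (fM x)); rewrite ler_pM2r//.
have : 0 <= M by rewrite -(pmulr_lge0 _ nx) (le_trans _ (fM x)).
case: (M : R[i]) => a b; rewrite !lecE /= => /andP[/eqP -> _].
by rewrite eqxx ler_norm.
Qed.

Lemma bounded_linear_id : idfun \in bounded_linear_pred.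
Proof.
by apply/bounded_linearP; split=> //; exists 1 => x; rewrite mul1r.
Qed.

Lemma bounded_linear_comp (S T : bop) : S \o T \in bounded_linear_pred.
Proof.
apply/bounded_linearP; split=> [a x y|]; first by rewrite /= !linearP.
have [M M0 SM] := bop_boundW S; have [N N0 TN] := bop_boundW T.
exists (M%:C%C * N%:C%C) => x; rewrite /= (le_trans (SM _))// -mulrA.
by rewrite ler_wpM2l// cplx_lecR.
Qed.

Definition bop1 : bop := Bop bounded_linear_id.
Definition bop_mul (S T : bop) : bop := Bop (bounded_linear_comp S T).

Lemma bopDE (S T : bop) x : (S + T) x = S x + T x. Proof. by []. Qed.
Lemma bopZE (a : cplx R) (T : bop) x : (a *: T) x = a *: T x.
Proof. by []. Qed.

Fact bop_mulA : associative bop_mul. Proof. by move=> S T W; exact: bop_ext. Qed.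
Fact bop_mul1l : left_id bop1 bop_mul. Proof. by move=> T; exact: bop_ext. Qed.
Fact bop_mul1r : right_id bop1 bop_mul. Proof. by move=> T; exact: bop_ext. Qed.
Fact bop_mulDl : left_distributive bop_mul +%R.
Proof. by move=> S T W; exact: bop_ext. Qed.
Fact bop_mulDr : right_distributive bop_mul +%R.
Proof. by move=> S T W; apply: bop_ext => x; exact: linearD. Qed.

HB.instance Definition _ := GRing.Zmodule_isPzRing.Build bop
  bop_mulA bop_mul1l bop_mul1r bop_mulDl bop_mulDr.

Lemma bop1E x : (1 : bop) x = x. Proof. by []. Qed.
Lemma bopME (S T : bop) x : (S * T) x = S (T x). Proof. by []. Qed.
Lemma bop_scaleAl (a : cplx R) (S T : bop) : a *: (S * T) = (a *: S) * T.
Proof. exact: bop_ext. Qed.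
Lemma bop_scaleAr (a : cplx R) (S T : bop) : a *: (S * T) = S * (a *: T).
Proof. by apply: bop_ext => x; rewrite bopZE !bopME bopZE linearZ. Qed.

(* The norm of a module over [cplx R] takes values in [cplx R], hence the
   detour through real parts. *)
Definition opnorm_set (T : bop) : set R :=
  [set complex.Re `|T x| | x in [set x | `|x| <= 1]].
Definition opnorm (T : bop) : cplx R := (sup (opnorm_set T))%:C%C.

Lemma normC_Re (x : V) : `|x| = (complex.Re `|x|)%:C%C.
Proof.
have := normr_ge0 x; case: (`|x| : R[i]) => a b.
by rewrite lecE /= => /andP[/eqP -> _].
Qed.

Lemma has_sup_opnorm (T : bop) : has_sup (opnorm_set T).
Proof.
split; first by exists (complex.Re `|T 0|), 0 => //=; rewrite normr0 ler01.
have [M M0 TM] := bop_boundW T; exists M => _ [x /= x1 <-].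
rewrite -cplx_lecR -normC_Re (le_trans (TM x))//.
by rewrite ler_piMr// cplx_lecR.
Qed.

Lemma opnormP (T : bop) x : `|T x| <= opnorm T * `|x|.
Proof.
have [->|x0] := eqVneq x 0; first by rewrite linear0 !normr0 mulr0.
have nx : 0 < `|x| by rewrite normr_gt0.
have nVx : `| `|x|^-1 *: x | = 1.
  by rewrite normrZ ger0_norm ?invr_ge0// mulVf ?gt_eqF.
rewrite -ler_pdivrMr//.
have -> : `|T x| / `|x| = `|T (`|x|^-1 *: x)|.
  by rewrite linearZ normrZ ger0_norm ?invr_ge0// mulrC.
rewrite [X in X <= _]normC_Re /opnorm cplx_lecR; apply: ub_le_sup.
  by have [] := has_sup_opnorm T.
by exists (`|x|^-1 *: x) => //=; rewrite nVx.
Qed.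

Lemma opnorm_le (T : bop) (M : R) : 0 <= M ->
  (forall x, `|T x| <= M%:C%C * `|x|) -> opnorm T <= M%:C%C.
Proof.
move=> M0 TM; rewrite /opnorm cplx_lecR; apply: ge_sup; first by have [] := has_sup_opnorm T.
move=> _ [x /= x1 <-]; rewrite -cplx_lecR -normC_Re (le_trans (TM x))//.
by rewrite ler_piMr// cplx_lecR.
Qed.

Lemma sup_opnorm_ge0 (T : bop) : 0 <= sup (opnorm_set T).
Proof.
apply: ub_le_sup; first by have [] := has_sup_opnorm T.
by exists 0 => /=; rewrite ?normr0 ?ler01// linear0 normr0.
Qed.

Fact opnormD (S T : bop) : opnorm (S + T) <= opnorm S + opnorm T.
Proof.
rewrite -rmorphD/=; apply: opnorm_le => [|x].
  by rewrite addr_ge0 ?sup_opnorm_ge0.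
by rewrite rmorphD mulrDl (le_trans (ler_normD _ _))// lerD ?opnormP.
Qed.

Fact opnormZ_le (a : cplx R) (T : bop) : opnorm (a *: T) <= `|a| * opnorm T.
Proof.
have aR : `|a| = (complex.Re `|a|)%:C%C.
  have := normr_ge0 a; case: (`|a| : R[i]) => u v.
  by rewrite lecE /= => /andP[/eqP -> _].
rewrite aR -rmorphM/=; apply: opnorm_le => [|x].
  by rewrite mulr_ge0 ?sup_opnorm_ge0// -cplx_lecR -aR normr_ge0.
rewrite bopZE normrZ rmorphM -mulrA -[X in _ <= X * _]aR.
by rewrite ler_wpM2l// opnormP.
Qed.

Fact opnormZ (a : cplx R) (T : bop) : opnorm (a *: T) = `|a| * opnorm T.
Proof.
apply/le_anti; rewrite opnormZ_le/=.
have [->|a0] := eqVneq a 0; first by rewrite normr0 mul0r /opnorm cplx_lecR sup_opnorm_ge0.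
rewrite -ler_pdivlMl ?normr_gt0//.
by rewrite -{1}[T](scalerK a0) -normfV opnormZ_le.
Qed.

Fact opnorm_eq0 (T : bop) : opnorm T = 0 -> T = 0.
Proof.
move=> T0; apply: bop_ext => x; apply/eqP; rewrite -normr_le0.
by rewrite (le_trans (opnormP T x))// T0 mul0r.
Qed.

HB.instance Definition _ :=
  Lmodule_isNormed.Build (cplx R) bop opnormD opnormZ opnorm_eq0.

Lemma bop_normE (T : bop) : `|T| = opnorm T. Proof. by []. Qed.

Lemma bop_normM (S T : bop) : `|S * T| <= `|S| * `|T|.
Proof.
rewrite !bop_normE -rmorphM/=; apply: opnorm_le => [|x].
  by rewrite mulr_ge0 ?sup_opnorm_ge0.
rewrite rmorphM bopME (le_trans (opnormP S _))// -mulrA.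
by rewrite ler_wpM2l ?opnormP// /opnorm cplx_lecR sup_opnorm_ge0.
Qed.

Definition bop_inverse (T S : bop) : Prop := S * T = 1 /\ T * S = 1.
Definition bop_invertible (T : bop) : Prop := exists S, bop_inverse T S.
(* By convention [0] when [T] is not invertible. *)
Definition bop_inv (T : bop) : bop := xget 0 (bop_inverse T).

Definition is_projection (P : bop) : Prop := P * P = P.

(* [dim_quotient W S n]: there are [n] vectors of [W] whose classes form a
   basis of [W / (W `&` S)], for [W] and [S] linear subspaces. *)
Definition dim_quotient (W S : set V) (n : nat) : Prop :=
  exists b : 'I_n -> V,
    [/\ forall i, W (b i),
        forall x, W x ->
          exists c : 'I_n -> cplx R, S (x - \sum_(i < n) c i *: b i)
      & forall c : 'I_n -> cplx R,
          S (\sum_(i < n) c i *: b i) -> forall i, c i = 0].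

Definition bop_ker (T : bop) : set V := [set x | T x = 0].
Definition dim_ker (T : bop) (n : nat) : Prop :=
  dim_quotient (bop_ker T) [set 0] n.
Definition dim_coker (T : bop) (n : nat) : Prop :=
  dim_quotient [set: V] (range T) n.

Definition fredholm (T : bop) : Prop :=
  (exists n, dim_ker T n) /\ (exists m, dim_coker T m).
Definition fredholm_index (T : bop) (i : int) : Prop :=
  exists n m, [/\ dim_ker T n, dim_coker T m & i = n%:Z - m%:Z].

End BoundedOperators.

Definition separable (T : topologicalType) : Prop :=
  exists2 D : set T, countable D & dense D.

Section Series.
Context {R : realType} {E : normedModType (cplx R)}.
Implicit Types f : cplx R -> E.

Definition has_taylor_series f (z0 : cplx R) (a : nat -> E) : Prop :=
  \forall z \near z0, series (fun n => (z - z0) ^+ n *: a n) @ \oo --> f z.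

(* Only the coefficients [c j] with [- d <= j] are relevant; the [n]-th term
   of the series is the one of exponent [n - d]. *)
Definition has_laurent_series f (z0 : cplx R) (d : nat) (c : int -> E) : Prop :=
  \forall z \near z0^',
    series (fun n => (z - z0) ^ (n%:Z - d%:Z) *: c (n%:Z - d%:Z)) @ \oo --> f z.

Definition analytic_at f (z0 : cplx R) : Prop := exists a, has_taylor_series f z0 a.
Definition analytic_on (U : set (cplx R)) f : Prop :=
  forall z, U z -> analytic_at f z.

Definition has_pole f (z0 : cplx R) (d : nat) : Prop :=
  exists g, [/\ analytic_at g z0, g z0 != 0
    & \forall z \near z0^', f z = (z - z0) ^- d *: g z].

End Series.

Section Factorization.
Context {R : realType} {B : completeNormedModType (cplx R)}.
Implicit Types (U : set (cplx R)) (A : cplx R -> bop B) (P H : nat -> bop B).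

(* [Aq k] is the Fredholm quotient of order [k] of [A] at [z0]; functions on
   [U] are total functions of which only the values on [U] matter. *)
Record successive_factorization U (z0 : cplx R) A P
    (Aq : nat -> cplx R -> bop B) : Prop := SuccessiveFactorization {
  sf_quotient0 : forall z, U z -> Aq 0%N z = A z ;
  sf_projection : forall k, is_projection (P k.+1) ;
  sf_range : forall k, range (P k.+1) = range (Aq k z0) ;
  sf_analytic : forall k, analytic_on U (Aq k.+1) ;
  sf_fredholm : forall k z, U z -> fredholm_index (Aq k.+1 z) 0 ;
  sf_factor : forall k z, U z ->
    Aq k z = (P k.+1 + (z - z0) *: (1 - P k.+1)) * Aq k.+1 z }.

(* For [- d <= j < 0] the subtractions on [nat] below are not truncated. *)
Definition laurent_coef H P (d : nat) (j : int) : bop B :=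
  if j < 0 then
    \sum_(0 <= l < (absz (j + d%:Z)%R).+1)
       H (absz (j + d%:Z)%R - l)%N * (P (d.+1 - l)%N - P (d - l)%N)
  else
    \sum_(0 <= l < d.+1) H (absz j + l)%N * (P l.+1 - P l).

End Factorization.

(* Main.v *)
Require Import Defs.
From HB Require Import structures.
From mathcomp Require Import all_boot all_order all_algebra.
From mathcomp Require Import complex.
From mathcomp Require Import all_classical all_reals all_analysis.

Set Implicit Arguments.
Unset Strict Implicit.
Unset Printing Implicit Defensive.

Import Order.TTheory GRing.Theory Num.Theory.
Import numFieldNormedType.Exports.

Local Open Scope classical_set_scope.
Local Open Scope ring_scope.

(** Put w = z - z0 and Q k = 1 - P k. Away from z0 every factor
    P k + w Q k is invertible, with inverse P k + w^-1 Q k, so that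
    [[
      A(z)^-1 = A^[d](z)^-1 (P d + w^-1 Q d) ... (P 1 + w^-1 Q 1).
    ]]
    A product of d factors is in general a sum of 2 ^ d words in the P k and
    Q k, which do not commute. It collapses here because the ranges are nested:
    ran P k contained in ran P (k+1) means P (k+1) P k = P k, which forces
    Q (k+1) P k = 0 and Q (k+1) Q k = Q (k+1), whatever the kernels of the
    projections are. By induction the product is ([inv_factor_prodS])
    [[
      sum_(l < d) w^-l (P (l+1) - P l) + w^-d (1 - P d),
    ]]
    in which 1 = P (d+1), so that the last term has the form of the others.

    Therefore w^d A(z)^-1 = g(z) with
    g(z) = A^[d](z)^-1 sum_(l <= d) w^l (P (d+1-l) - P (d-l)). This g is
    analytic at z0 because it is a polynomial in w times a function with a
    Taylor series ([taylor_sum], [taylor_shift], [taylorMr]), and the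
    coefficients of the product are the announced ones ([laurent_coefE]).
    Dividing by w^d gives the Laurent series. The order of the pole is exactly
    d, since g(z0) = A^[d](z0)^-1 (1 - P d) vanishes only if P d = 1. *)

Section Inverses.
Context {R : realType} (V : normedModType (cplx R)).
Implicit Types S T : bop V.

Lemma bop_invP T : bop_invertible T -> bop_inverse T (bop_inv T).
Proof. exact: xgetPex. Qed.

Lemma bop_inv_left T S : bop_invertible T -> S * T = 1 -> bop_inv T = S.
Proof.
move=> /bop_invP[_ TT'] ST.
by rewrite -[S]mulr1 -TT' mulrA ST mul1r.
Qed.

Lemma bop_invertibleM S T :
  bop_invertible S -> bop_invertible T -> bop_invertible (S * T).
Proof.
move=> [S' [S'S SS']] [T' [T'T TT']]; exists (T' * S'); split.
  by rewrite -mulrA (mulrA S') S'S mul1r.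
by rewrite -mulrA (mulrA T) TT' mul1r.
Qed.

End Inverses.

Section Projections.
Context {R : realType} (V : normedModType (cplx R)).
Implicit Types P : bop V.

(** The only way in which nested ranges enter: they determine the product in
    this order, while Q * P depends on the kernel of Q. *)
Lemma projection_range_fix P (Q : bop V) : is_projection P -> range Q `<=` range P ->
  P * Q = Q.
Proof.
move=> PP QP; apply: bop_ext => x; rewrite bopME.
by have [|y _ <-] := QP (Q x); [exists x|rewrite -bopME PP].
Qed.

Lemma proj_factorM P (a b : cplx R) : is_projection P ->
  (P + a *: (1 - P)) * (P + b *: (1 - P)) = P + (a * b) *: (1 - P).
Proof.
move=> PP; have PQ : P * (1 - P) = 0 by rewrite mulrBr mulr1 PP subrr.
have QP : (1 - P) * P = 0 by rewrite mulrBl mul1r PP subrr.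
have QQ : (1 - P) * (1 - P) = 1 - P by rewrite mulrBr mulr1 QP subr0.
rewrite mulrDl !mulrDr -!bop_scaleAl -!bop_scaleAr PP PQ QP QQ.
by rewrite !scaler0 addr0 add0r scalerA.
Qed.

Lemma proj_factor_inverse P (w : cplx R) : is_projection P -> w != 0 ->
  bop_inverse (P + w *: (1 - P)) (P + w^-1 *: (1 - P)).
Proof.
by move=> PP w0; split; rewrite proj_factorM// ?mulVf ?mulfV// scale1r addrC subrK.
Qed.

(** Closed form of
    (P k + w^-1 (1 - P k)) ... (P 1 + w^-1 (1 - P 1)) for projections with
    nested ranges and P 0 = 0; see [inv_factor_prodS]. *)
Definition inv_factor_prod (P : nat -> bop V) (w : cplx R) (k : nat) : bop V :=
  \sum_(l < k) w ^- l *: (P l.+1 - P l) + w ^- k *: (1 - P k).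

(** The new factor fixes P l for l <= k, hence every term of the sum; it only
    splits the last term, 1 - P k, into P k.+1 - P k, at the same power of w,
    and 1 - P k.+1, at the next one. *)
Lemma inv_factor_prodS (P : nat -> bop V) (w : cplx R) (k : nat) :
  is_projection (P k.+1) ->
  (forall l, (l <= k)%N -> P k.+1 * P l = P l) ->
  (P k.+1 + w^-1 *: (1 - P k.+1)) * inv_factor_prod P w k =
  inv_factor_prod P w k.+1.
Proof.
move=> PP Pfix; set F := P k.+1 + _.
have fixF l : (l <= k)%N -> F * P l = P l.
  by move=> lk; rewrite mulrDl -bop_scaleAl mulrBl mul1r Pfix// subrr scaler0 addr0.
rewrite /inv_factor_prod big_ord_recr/= mulrDr mulr_sumr -addrA; congr (_ + _).
  by apply: eq_bigr => l _; rewrite -bop_scaleAr mulrBr !fixF// ltnW.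
rewrite -bop_scaleAr mulrBr mulr1 fixF// /F addrAC scalerDr scalerA.
by rewrite exprSr invfM.
Qed.

End Projections.

Section Taylor.
Context {R : realType}.

Section Module.
Context {E : normedModType (cplx R)}.
Implicit Types (f : cplx R -> E) (a : nat -> E).

Lemma taylor_sum (I : Type) (r : seq I) (F : I -> cplx R -> E)
    (a : I -> nat -> E) (z0 : cplx R) :
  (forall i, has_taylor_series (F i) z0 (a i)) ->
  has_taylor_series (fun z => \sum_(i <- r) F i z) z0
    (fun n => \sum_(i <- r) a i n).
Proof.
move=> Fa; elim: r => [|i r IH].
  near=> z; rewrite big_nil.
  rewrite (_ : series _ = fun=> 0); first exact: cvg_cst.
  by apply/funext => n; rewrite /series/= big1// => m _; rewrite big_nil scaler0.
apply: filterS2 (Fa i) IH => z Fz rz; rewrite big_cons.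
rewrite [X in X @ _ --> _](_ : _ = series (fun n => (z - z0) ^+ n *: a i n) +
  series (fun n => (z - z0) ^+ n *: \sum_(i <- r) a i n)).
  exact: cvgD.
apply/funext => n; rewrite fctE /series/= -big_split/=.
by apply: eq_bigr => m _; rewrite big_cons scalerDr.
Unshelve. all: by end_near. Qed.

Lemma taylor_shift f z0 a l : has_taylor_series f z0 a ->
  has_taylor_series (fun z => (z - z0) ^+ l *: f z) z0
    (fun n => if (n < l)%N then 0 else a (n - l)%N).
Proof.
apply: filterS => z fz; rewrite -(cvg_shiftn l).
rewrite [X in X @ _ --> _](_ : _ =
  (z - z0) ^+ l \*: series (fun n => (z - z0) ^+ n *: a n)).
  exact: cvgZl_tmp.
apply/funext => n; rewrite /series/= addnC (@big_cat_nat _ _ _ l)//= ?leq_addr//.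
rewrite big_nat big1 ?add0r => [|m /andP[_ ml]]; last by rewrite ml scaler0.
rewrite -{1}[l]add0n big_addn addKn scaler_sumr; apply: eq_bigr => m _.
by rewrite ltnNge leq_addl/= addnK scalerA -exprD addnC.
Qed.

End Module.

Lemma cvgMr_bop (V : normedModType (cplx R)) (u : nat -> bop V) (S T : bop V) :
  u @ \oo --> S -> (fun n => u n * T) @ \oo --> S * T.
Proof.
move=> uS; apply/cvgrPdist_lt => e e0.
have T1 : 0 < `|T| + 1 by rewrite ltr_wpDl.
near=> n; rewrite -mulrBl (le_lt_trans (bop_normM _ _))//.
apply: (@le_lt_trans _ _ (`|S - u n| * (`|T| + 1))).
  by rewrite ler_wpM2l// lerDl.
rewrite -ltr_pdivlMr//; near: n; move/cvgrPdist_lt: uS; apply.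
by rewrite divr_gt0.
Unshelve. all: by end_near. Qed.

Lemma taylorMr (V : normedModType (cplx R)) (f : cplx R -> bop V) z0 a T :
  has_taylor_series f z0 a ->
  has_taylor_series (fun z => f z * T) z0 (fun n => a n * T).
Proof.
apply: filterS => z fz.
rewrite [X in X @ _ --> _](_ : _ =
  (fun n => series (fun n => (z - z0) ^+ n *: a n) n * T)).
  exact: cvgMr_bop.
apply/funext => n; rewrite /series/= mulr_suml.
by apply: eq_bigr => m _; rewrite bop_scaleAl.
Qed.

End Taylor.

Section Factorization.
Context {R : realType} {B : completeNormedModType (cplx R)}.

(** The two cases of [laurent_coef] are one Cauchy product, of H with the
    coefficients P (d.+1 - l) - P (d - l) for l <= d: a negative exponent is one
    where n < d truncates the product, and for a nonnegative one the index is
    reversed. *)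
Lemma laurent_coefE (H P : nat -> bop B) (d n : nat) :
  laurent_coef H P d (n%:Z - d%:Z) =
  \sum_(0 <= l < d.+1)
    if (n < l)%N then 0 else H (n - l)%N * (P (d.+1 - l)%N - P (d - l)%N).
Proof.
rewrite /laurent_coef subr_lt0 ltz_nat; case: ltnP => nd.
  rewrite subrK absz_nat [RHS](@big_cat_nat _ _ _ n.+1)//= 1?ltnW//.
  rewrite [X in _ = _ + X]big_nat_cond [X in _ = _ + X]big1 ?addr0; last first.
    by move=> l /andP[/andP[-> _] _].
  by apply: eq_big_nat => l /andP[_ ln]; rewrite ltnNge -ltnS ln.
rewrite subzn// absz_nat [RHS]big_nat_rev/=; apply: eq_big_nat => l /andP[_ ld].
have {}ld : (l <= d)%N by [].
rewrite add0n subSS subKn// ltnNge (leq_trans (leq_subr _ _) nd)/=.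
by rewrite subSn ?leq_subr// subKn// subnBA// addnBAC.
Qed.

(** Solving each factorization step for Aq k.+1 z multiplies on the left by an
    inverse factor, and these accumulate into [inv_factor_prod]. The inverse
    factors are invertible, so Aq k z inherits invertibility from A z. *)
Lemma fredholm_quotientE (U : set (cplx R)) z0 (A : cplx R -> bop B) P Aq d z :
  successive_factorization U z0 A P Aq -> P 0%N = 0 ->
  (forall k, (0 < k < d)%N -> range (P k) `<=` range (P k.+1)) ->
  U z -> z != z0 -> bop_invertible (A z) ->
  forall k, (k <= d)%N ->
  bop_invertible (Aq k z) /\ Aq k z = inv_factor_prod P (z - z0) k * A z.
Proof.
move=> fA P0 nP Uz zz0 Az; elim=> [_|k IH kd].
  rewrite (sf_quotient0 fA)//; split=> //.
  by rewrite /inv_factor_prod big_ord0 add0r expr0 invr1 scale1r P0 subr0 mul1r.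
have w0 : z - z0 != 0 by rewrite subr_eq0.
have [Akinv Ak] := IH (ltnW kd).
have PP := sf_projection fA.
have [FF' F'F] := proj_factor_inverse (PP k) w0.
have -> : Aq k.+1 z = (P k.+1 + (z - z0)^-1 *: (1 - P k.+1)) * Aq k z.
  by rewrite (sf_factor fA k Uz) mulrA FF' mul1r.
split; first by apply: bop_invertibleM => //; eexists; split; eassumption.
rewrite Ak mulrA inv_factor_prodS//.
have rg : forall m l, (l <= m)%N -> (m < d)%N -> range (P l) `<=` range (P m.+1).
  move=> m l; case: l => [_ _ _ [x _ <-]|l].
    by exists 0 => //; rewrite P0 linear0.
  move=> /subnK <-; elim: (m - l.+1)%N => [|i IHi] md; first exact: nP.
  by apply: (subset_trans (IHi (ltnW md))); apply: nP.
by move=> l lk; apply: projection_range_fix => //; exact: rg.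
Qed.

End Factorization.

Theorem proposition6 (R : realType) (B : completeNormedModType (cplx R))
    (sepB : separable B)
    (U : set (cplx R)) (openU : open U) (connU : connected U)
    (z0 : cplx R) (Uz0 : U z0)
    (A : cplx R -> bop B) (anA : analytic_on U A)
    (fredA : forall z, U z -> fredholm (A z))
    (invA : forall z, U z -> z != z0 -> bop_invertible (A z))
    (ninvA : ~ bop_invertible (A z0))
    (P : nat -> bop B) (Aq : nat -> cplx R -> bop B)
    (factA : successive_factorization U z0 A P Aq)
    (d : nat) (d_gt0 : (0 < d)%N)
    (invAd : bop_invertible (Aq d z0))
    (nestP : forall k, (0 < k < d)%N -> range (P k) `<=` range (P k.+1))
    (P0 : P 0%N = 0) (Pd : P d <> 1)
    (PdS : forall j, (0 < j)%N -> P (d + j)%N = 1)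
    (H : nat -> bop B)
    (taylorH : has_taylor_series (fun z => bop_inv (Aq d z)) z0 H) :
  has_pole (fun z => bop_inv (A z)) z0 d /\
  has_laurent_series (fun z => bop_inv (A z)) z0 d (laurent_coef H P d).
Proof.
pose w z : cplx R := z - z0.
pose g z := \sum_(0 <= l < d.+1)
  w z ^+ l *: (bop_inv (Aq d z) * (P (d.+1 - l)%N - P (d - l)%N)).
have Pd1 : P d.+1 = 1 by rewrite -addn1 PdS.
have gtaylor : has_taylor_series g z0 (fun n => laurent_coef H P d (n%:Z - d%:Z)).
  under [X in has_taylor_series _ _ X]eq_fun do rewrite laurent_coefE.
  apply: taylor_sum => l; exact: taylor_shift (taylorMr _ taylorH).
have gE z : U z -> z != z0 -> bop_inv (A z) = w z ^- d *: g z.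
  move=> Uz zz0; have w0 : w z != 0 by rewrite subr_eq0.
  have [Adinv Ad] :=
    fredholm_quotientE factA P0 nestP Uz zz0 (invA _ Uz zz0) (leqnn d).
  have -> : bop_inv (A z) = bop_inv (Aq d z) * inv_factor_prod P (w z) d.
    apply: bop_inv_left (invA _ Uz zz0) _.
    by rewrite -mulrA -Ad; have [] := bop_invP Adinv.
  (* Writing 1 as P d.+1 makes the last term the case l = d of the sum. *)
  rewrite /inv_factor_prod -Pd1.
  rewrite -(big_ord_recr d (fun l => w z ^- l *: (P l.+1 - P l))).
  rewrite -(big_mkord xpredT (fun l => w z ^- l *: (P l.+1 - P l))).
  rewrite big_nat_rev/= mulr_sumr scaler_sumr; apply: eq_big_nat => l /andP[_ ld].
  have {}ld : (l <= d)%N by [].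
  rewrite add0n subSS -bop_scaleAr scalerA -subSn//; congr (_ *: _).
  by rewrite expfB_cond ?(negPf w0)// invfM invrK.
have nearU : \forall z \near z0^', bop_inv (A z) = w z ^- d *: g z.
  near=> z; apply: gE.
    by near: z; apply: nbhs_dnbhs; exact: open_nbhs_nbhs.
  by near: z; exact: nbhs_dnbhs_neq.
split.
  exists g; split => //; first by eexists; exact: gtaylor.
  (* At z0 only the term l = 0 of g survives. *)
  rewrite /g big_nat_recl//= big1_seq ?addr0; last first.
    by move=> l _; rewrite /w subrr expr0n/= scale0r.
  rewrite expr0 scale1r !subn0 Pd1; apply/eqP => e; apply: Pd.
  have [_ Adinv] := bop_invP invAd.
  have : Aq d z0 * (bop_inv (Aq d z0) * (1 - P d)) = 1 - P d.
    by rewrite mulrA Adinv mul1r.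
  by rewrite e mulr0 => /eqP; rewrite eq_sym subr_eq0 => /eqP.
near=> z.
have -> : bop_inv (A z) = w z ^- d *: g z by near: z.
have wz0 : w z != 0 by rewrite subr_eq0; near: z; exact: nbhs_dnbhs_neq.
have gz : series (fun n => w z ^+ n *: laurent_coef H P d (n%:Z - d%:Z)) @ \oo
    --> g z by near: z; exact: nbhs_dnbhs gtaylor.
rewrite [X in X @ _ --> _](_ : _ = w z ^- d \*: series (fun n =>
  w z ^+ n *: laurent_coef H P d (n%:Z - d%:Z))).
  exact: cvgZl_tmp.
apply/funext => n; rewrite /series/= scaler_sumr; apply: eq_bigr => m _.
by rewrite scalerA expfzDr// mulrC exprnN.
Unshelve. all: by end_near. Qed.
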